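(* Let $X$ and $Y$ be locally compact Hausdorff spaces. If $T\colon C_0^+(X,\mathbb{R})\to C_0^+(Y,\mathbb{R})$ is a surjective phase-isometry, then there exists a unique surjective linear isometry $\widetilde{T}\colon C_0(X,\mathbb{R})\to C_0(Y,\mathbb{R})$ such that $\widetilde{T}=T$ on $C_0^+(X,\mathbb{R})$.
   Context: For a locally compact Hausdorff space $L$, $C_0(L,\mathbb{R})$ denotes the real Banach space of all continuous real-valued functions on $L$ vanishing at infinity, equipped with the supremum norm $\|h\|_\infty=\sup_{x\in L}|h(x)|$. Its positive cone is $C_0^+(L,\mathbb{R})=\{h\in C_0(L,\mathbb{R}): h\ge 0\}$. A map $T\colon C_0^+(X,\mathbb{R})\to C_0^+(Y,\mathbb{R})$ (not assumed linear, additive or continuous) is a phase-isometry if the equality of sets $\{\|T(f)+T(g)\|_\infty,\ \|T(f)-T(g)\|_\infty\}=\{\|f+g\|_\infty,\ \|f-g\|_\infty\}$ holds for all $f,g\in C_0^+(X,\mathbb{R})$. *)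

(* Defs.v *)
From HB Require Import structures.
From mathcomp Require Import all_boot all_order all_algebra.
From mathcomp Require Import all_classical all_reals.
From mathcomp Require Import topology normedtype.

Set Implicit Arguments.
Unset Strict Implicit.
Unset Printing Implicit Defensive.

Import Order.TTheory GRing.Theory Num.Theory.
Import numFieldNormedType.Exports.

Local Open Scope classical_set_scope.
Local Open Scope ring_scope.

Definition vanishes_at_infinity (R : realType) (L : topologicalType)
    (f : L -> R) : Prop :=
  forall e : R, 0 < e ->
    exists2 K : set L, compact K & forall x, ~ K x -> `|f x| < e.

Definition C0_pred (R : realType) (L : topologicalType) : {pred L -> R} :=
  mem [set f : L -> R | continuous f /\ vanishes_at_infinity f].

Record C0 (L : topologicalType) (R : realType) := MkC0 {
  C0_fun :> L -> R ;
  _ : C0_fun \in @C0_pred R L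
}.

Section C0_normed.
Context (L : topologicalType) (R : realType).

HB.instance Definition _ := [isSub for @C0_fun L R].
HB.instance Definition _ := [Choice of C0 L R by <:].

Lemma C0_predP (f : L -> R) :
  reflect (continuous f /\ vanishes_at_infinity f) (f \in @C0_pred R L).
Proof. by apply: (iffP idP) => [/set_mem|fP]; [|exact: mem_set]. Qed.

Lemma C0_continuous (f : C0 L R) : continuous f.
Proof. by case: f => f /= /C0_predP[]. Qed.

Lemma C0_vanishes (f : C0 L R) : vanishes_at_infinity f.
Proof. by case: f => f /= /C0_predP[]. Qed.

Lemma C0_submod_closed : submod_closed (@C0_pred R L).
Proof.
split.
  apply/C0_predP; split; first by move=> x; exact: (@cvg_cst R).
  by move=> e e0; exists set0 => [|x _]; [exact: compact0|rewrite normr0].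
move=> a f g /C0_predP[cf vf] /C0_predP[cg vg]; apply/C0_predP; split.
  by move=> x; apply: (@cvgD R R); [apply: cvgMl_tmp; exact: cf|exact: cg].
move=> e e0; have a0 : 0 < `|a| + 1 by rewrite ltr_wpDl.
have d0 : 0 < e / 2 / (`|a| + 1) by rewrite !divr_gt0.
have [K cK Kf] := vf _ d0; have [K' cK' Kg] := vg _ (divr_gt0 e0 (ltr0Sn R 1)).
exists (K `|` K'); first exact: compactU.
move=> x /not_orP[/Kf fx /Kg gx].
rewrite (le_lt_trans (ler_normD _ _))// [ltRHS]splitr ler_ltD// normrM.
rewrite ltr_pdivlMr// in fx; rewrite (le_trans _ (ltW fx))// mulrC ler_wpM2l//.
by rewrite lerDl.
Qed.

HB.instance Definition _ :=
  GRing.isSubmodClosed.Build R (L -> R) (@C0_pred R L) C0_submod_closed.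
HB.instance Definition _ := [SubChoice_isSubLmodule of C0 L R by <:].

Lemma C0_bounded (f : C0 L R) : has_ubound [set `|f x| | x in [set: L]].
Proof.
have [K cK Kf] := C0_vanishes f (@ltr01 R).
have : compact ((fun x => `|f x|) @` K).
  apply: continuous_compact => //; apply: continuous_subspaceT => x.
  by apply: cvg_norm; exact: C0_continuous.
move=> /compact_bounded[M [_ /(_ (`|M| + 1))]].
move=> /(_ (le_lt_trans (ler_norm M) _)); rewrite ltrDl => /(_ ltr01) MK.
exists (`|M| + 1) => _ [x _ <-]; have [Kx|/Kf/ltW fx] := pselect (K x).
  by have := MK `|f x|; rewrite /= normr_id; apply; exists x.
by rewrite (le_trans fx)// lerDr.
Qed.

(* If L is empty, this is the supremum of the empty set of reals, that is 0 *)
Definition C0_norm (f : C0 L R) : R := sup [set `|f x| | x in [set: L]].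

Lemma C0_norm_ub (f : C0 L R) x : `|f x| <= C0_norm f.
Proof. by apply: ub_le_sup; [exact: C0_bounded|exists x]. Qed.

Lemma C0_norm_ge0 (f : C0 L R) : 0 <= C0_norm f.
Proof.
have [[x _]|/set0P/negP/negPn/eqP L0] := pselect ([set: L] !=set0).
  exact: le_trans (C0_norm_ub f x).
by rewrite /C0_norm L0 image_set0 sup0.
Qed.

Lemma C0_norm_le (f : C0 L R) (M : R) :
  0 <= M -> (forall x, `|f x| <= M) -> C0_norm f <= M.
Proof.
move=> M0 fM; have [[x _]|/set0P/negP/negPn/eqP L0] := pselect ([set: L] !=set0).
  by apply: ge_sup => [|_ [y _ <-]//]; exists `|f x|, x.
by rewrite /C0_norm L0 image_set0 sup0.
Qed.

Lemma C0_ler_normD (f g : C0 L R) : C0_norm (f + g) <= C0_norm f + C0_norm g.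
Proof.
apply: C0_norm_le => [|x]; first by rewrite addr_ge0// C0_norm_ge0.
by rewrite (le_trans (ler_normD _ _))// lerD// C0_norm_ub.
Qed.

Lemma C0_normrZ (a : R) (f : C0 L R) : C0_norm (a *: f) = `|a| * C0_norm f.
Proof.
have le b (g : C0 L R) : C0_norm (b *: g) <= `|b| * C0_norm g.
  apply: C0_norm_le => [|x]; first by rewrite mulr_ge0// C0_norm_ge0.
  by rewrite normrM ler_wpM2l// C0_norm_ub.
apply/eqP; rewrite eq_le le/=; have [->|a0] := eqVneq a 0.
  by rewrite normr0 mul0r C0_norm_ge0.
have := le a^-1 (a *: f); rewrite scalerA mulVf// scale1r normfV.
by rewrite mulrC ler_pdivlMr ?normr_gt0// mulrC.
Qed.

Lemma C0_normr0_eq0 (f : C0 L R) : C0_norm f = 0 -> f = 0.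
Proof.
move=> f0; apply/val_inj/funext => x; apply/eqP.
by rewrite -normr_le0 -f0; exact: C0_norm_ub.
Qed.

HB.instance Definition _ := Lmodule_isNormed.Build R (C0 L R)
  C0_ler_normD C0_normrZ C0_normr0_eq0.

End C0_normed.

Record C0plus (L : topologicalType) (R : realType) := MkC0plus {
  C0plus_val :> C0 L R ;
  C0plus_ge0 : forall x, 0 <= C0plus_val x
}.

Definition phase_isometry (R : realType) (X Y : topologicalType)
    (T : C0plus X R -> C0plus Y R) : Prop :=
  forall f g : C0plus X R,
    [set `|(T f : C0 Y R) + (T g : C0 Y R)| ;
         `|(T f : C0 Y R) - (T g : C0 Y R)|] =
    [set `|(f : C0 X R) + (g : C0 X R)| ;
         `|(f : C0 X R) - (g : C0 X R)|].

Definition isometric_map (R : realType) (V W : normedModType R) (S : V -> W) : Prop :=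
  forall u v : V, `|S u - S v| = `|u - v|.

(* Main.v *)
(* Since |f - g| <= f + g pointwise for f, g >= 0, a phase-isometry T preserves
   both |f - g| and |f + g|.  The norms of sums determine the order of the cone
   (f <= g iff |f + h| <= |g + h| for all h >= 0), so T is an isometric order
   isomorphism of the cones.  It therefore maps the order-convex hull of f and g
   onto that of T f and T g; both are bounded and symmetric about the midpoints,
   and Väisälä's proof of the Mazur-Ulam theorem shows that T preserves these
   midpoints.  Hence T is additive, and it extends by
   S f = T (f^+) - T (f^-). *)
Require Import Defs.
From mathcomp Require Import all_boot all_order all_algebra.
From mathcomp Require Import all_classical all_reals.
From mathcomp Require Import topology normedtype.
From mathcomp Require Import lra.

Import Order.TTheory GRing.Theory Num.Theory.
Import numFieldNormedType.Exports.
Local Open Scope classical_set_scope.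
Local Open Scope ring_scope.

(** * Metric tools: centres fixed by isometries, linearity of additive isometries *)

Section symmetric_sets.
Context {R : realType}.

Lemma doubling_le0 (a M : R) : (forall n, a *+ (2 ^ n) <= M) -> a <= 0.
Proof.
move=> aM; rewrite leNgt; apply/negP => a0.
have [n Mn] : exists n, M / a < n%:R.
  by exists (Num.bound `|M / a|);
    exact: le_lt_trans (ler_norm _) (archi_boundP (normr_ge0 _)).
have := aM n; apply/negP; rewrite -ltNge -mulr_natl.
rewrite -ltr_pdivrMr// (lt_le_trans Mn)// ler_nat.
by rewrite ltnW// ltn_expl.
Qed.

(* Here d is a metric bounded by M on A, rho the reflection about m, and psi the
   inverse of phi; replacing phi by rho psi rho phi doubles d (phi m) m. *)
Lemma isometry_fixes_center (P : Type) (d : P -> P -> R) (A : set P)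
    (rho : P -> P) (m : P) (M : R) (phi psi : P -> P) :
  A m -> {homo rho : u / A u} -> (forall u, A u -> rho (rho u) = u) ->
  (forall u v, A u -> A v -> d (rho u) (rho v) = d u v) ->
  (forall u, A u -> d (rho u) u = d u m *+ 2) -> rho m = m ->
  (forall u v, A u -> A v -> d u v <= M) ->
  {homo phi : u / A u} -> {homo psi : u / A u} ->
  (forall u, A u -> phi (psi u) = u) -> (forall u, A u -> psi (phi u) = u) ->
  (forall u v, A u -> A v -> d (phi u) (phi v) = d u v) ->
  d (phi m) m <= 0.
Proof.
move=> Am Ar rr rd r2 rm dM Aphi Apsi phiK psiK phid.
apply: (@doubling_le0 _ M) => n.
elim: n phi psi Aphi Apsi phiK psiK phid => [|n IH] phi psi Aphi Apsi phiK psiK phid.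
  by rewrite mulr1n; apply: dM => //; exact: Aphi.
have psid u v : A u -> A v -> d (psi u) (psi v) = d u v.
  by move=> Au Av; rewrite -phid ?phiK//; exact: Apsi.
have Apm : A (phi m) by exact: Aphi.
(* Doubling: [d (phi m) m *+ 2] is [d (rho (phi m)) (phi m)]; applying [psi], which sends [phi m] to
   [m], and then [rho], which fixes [m], keeps this distance. *)
have -> : d (phi m) m *+ 2 ^ n.+1 = d (rho (psi (rho (phi m)))) m *+ 2 ^ n.
  have Aprp : A (psi (rho (phi m))) by exact/Apsi/Ar.
  have := psid _ _ (Ar _ Apm) Apm; rewrite psiK// => e.
  by have := rd _ _ Aprp Am; rewrite rm expnS mulrnA -r2// -e => ->.
apply: (IH (rho \o psi \o rho \o phi) (psi \o rho \o phi \o rho)) => /=.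
- by move=> u Au; apply/Ar/Apsi/Ar/Aphi.
- by move=> u Au; apply/Apsi/Ar/Aphi/Ar.
- move=> u Au; rewrite phiK; last by apply/Ar/Aphi/Ar.
  by rewrite rr ?psiK ?rr//; [exact: Ar|apply/Aphi/Ar].
- move=> u Au; rewrite rr ?phiK ?rr ?psiK//.
  + exact: Aphi.
  + by apply/Ar/Aphi.
  + by apply/Apsi/Ar/Aphi.
- move=> u v Au Av; rewrite rd ?psid ?rd ?phid//.
  all: by do ?[done|apply: Ar|apply: Apsi|apply: Aphi].
Qed.

(** Additivity gives integer multiples; norm preservation then controls the error made by replacing
    a real scalar with a dyadic approximation. *)
Lemma additive_isometry_linear (V W : normedModType R) (S : V -> W) :
  {morph S : u v / u + v} -> isometric_map S -> linear S.
Proof.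
move=> SD Si; have S0 : S 0 = 0 by apply: (addrI (S 0)); rewrite -SD !addr0.
have SN u : S (- u) = - S u by apply/eqP; rewrite -addr_eq0 -SD addNr S0.
have SMn n u : S (u *+ n) = S u *+ n.
  by elim: n => [|n IH]; rewrite ?mulr0n// !mulrS SD IH.
have Sn u : `|S u| = `|u| by have := Si u 0; rewrite S0 !subr0.
have Spos (a : R) u : 0 <= a -> S (a *: u) = a *: S u.
  move=> a0; apply/eqP; rewrite -subr_eq0 -normr_le0.
  apply: (@doubling_le0 _ (`|u| + `|u|)) => n.
  (* With [k] the integer part of [a *+ N], integer multiples pass through [S], so [N] times the
     defect of homogeneity only involves the fractional part of [a *+ N]. It is bounded by
     [|u| + |u|] for all [n], hence the defect vanishes. *)
  set N := (2 ^ n)%N; have aN0 : 0 <= a *+ N by rewrite mulrn_wge0.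
  have /andP[kl kr] := truncn_itv aN0; set k := Num.truncn _ in kl kr.
  have -> : `|S (a *: u) - a *: S u| *+ N =
      `|S ((a *: u) *+ N - u *+ k) - (a *+ N - k%:R) *: S u|.
    rewrite -normrMn SD SN !SMn scalerBl scaler_nat -scalerMnl opprB addrA subrK.
    by rewrite mulrnBl.
  rewrite (le_trans (ler_normB _ _))// Sn normrZ Sn scalerMnl -(scaler_nat k).
  rewrite -scalerBl normrZ ger0_norm; last by rewrite subr_ge0.
  have : a *+ N - k%:R <= 1 by move: kr; rewrite -natr1; lra.
  by move=> h; rewrite lerD// ler_piMl.
move=> a u v; rewrite SD; congr (_ + _).
have [/Spos//|a0] := leP 0 a.
by rewrite -[a]opprK scaleNr SN Spos ?scaleNr// oppr_ge0 ltW.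
Qed.

End symmetric_sets.

Local Notation "u %:C" := (C0plus_val u) (at level 1, left associativity, format "u %:C").

(** * The positive cone: order, norm, and reflections of order hulls *)

Section cone.
Context {L : topologicalType} {R : realType}.
Implicit Types (f g : C0 L R) (u v w : C0plus L R).

Lemma C0_addE f g x : (f + g) x = f x + g x. Proof. by []. Qed.
Lemma C0_oppE f x : (- f) x = - f x. Proof. by []. Qed.
Lemma C0_scaleE a f x : (a *: f) x = a * f x. Proof. by []. Qed.
Definition C0E := (C0_addE, C0_oppE, C0_scaleE).

Lemma C0P f g : f =1 g -> f = g.
Proof. by move=> fg; apply/val_inj/funext. Qed.

Lemma C0plusP u v : u =1 v -> u = v.
Proof.
case: u v => [f f0] [g g0] /= /C0P fg; subst g.
by rewrite (Prop_irrelevance f0 g0).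
Qed.

Lemma C0_le_norm f g : (forall x, `|f x| <= `|g x|) -> `|f| <= `|g|.
Proof.
move=> fg; apply: C0_norm_le => [|x]; first exact: C0_norm_ge0.
exact: le_trans (fg x) (C0_norm_ub _ _).
Qed.

Lemma pospart_C0 f : (fun x => Num.max (f x) 0) \in @C0_pred R L.
Proof.
apply/C0_predP; split.
  by move=> x; apply: (@continuous_max R L f (fun=> 0));
    [exact: C0_continuous|exact: cvg_cst].
move=> e /(C0_vanishes f)[K cK fK]; exists K => // x /fK.
by apply: le_lt_trans; rewrite ger0_norm ?le_max ?lexx ?orbT// ge_max ler_norm normr_ge0.
Qed.

Lemma pospart_ge0 f x : 0 <= MkC0 (pospart_C0 f) x.
Proof. by rewrite /= le_max lexx orbT. Qed.

(** Also serves as a total constructor of cone elements: a function known to be nonnegative is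
    returned unchanged ([pospart_id]). *)
Definition pospart f : C0plus L R := MkC0plus (@pospart_ge0 f).

Lemma pospartE f x : pospart f x = Num.max (f x) 0. Proof. by []. Qed.

Lemma pospart_id f : (forall x, 0 <= f x) -> (pospart f)%:C = f.
Proof. by move=> f0; apply: C0P => x; rewrite pospartE; apply/max_idPl. Qed.

Lemma pospartB f : (pospart f)%:C - (pospart (- f))%:C = f.
Proof.
by apply: C0P => x; rewrite !C0E !pospartE C0E; case: leP => ?; case: leP => ?; lra.
Qed.

(** Tells which of the two norms in the phase-isometry condition is the larger, so that the equality
    of sets splits into two equalities. *)
Lemma C0plus_normB_le_normD u v : `|u%:C - v%:C| <= `|u%:C + v%:C|.
Proof.
apply: C0_le_norm => x; rewrite !C0E.
have u0 := C0plus_ge0 u x; have v0 := C0plus_ge0 v x.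
by rewrite [leRHS]ger0_norm ?addr_ge0// ler_norml; lra.
Qed.

Definition le_cone u v := forall x, u x <= v x.

Lemma le_cone_normP u v :
  le_cone u v <-> forall w, `|u%:C + w%:C| <= `|v%:C + w%:C|.
Proof.
split=> [uv w|uv x].
  apply: C0_le_norm => x; rewrite !C0E.
  have := uv x; have := C0plus_ge0 u x; have := C0plus_ge0 w x => w0 u0 uvx.
  by rewrite !ger0_norm; lra.
(* With d = (u - v)^+, take w such that v + w = max (v, N d), where
   N |d| = |v|; then |v + w| <= N |d| and u + w >= (N + 1) d. *)
pose d : C0 L R := pospart (u%:C - v%:C).
suff : `|d| = 0.
  move=> d0; have := C0_norm_ub d x; rewrite [C0_norm d]d0 normr_le0 => /eqP.
  by rewrite /d pospartE !C0E; case: (leP _ 0); lra.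
apply/eqP; apply/negPn/negP => dn0; have dgt0 : 0 < `|d| by rewrite lt_def dn0 normr_ge0.
pose N : R := `|v%:C| / `|d|.
have N0 : (0 : R) <= N by rewrite divr_ge0.
have Nd : N * `|d| = `|v%:C| by rewrite divfK.
pose w := pospart (N *: d - v%:C).
have le1 : `|v%:C + w%:C| <= N * `|d|.
  apply: C0_norm_le => [|z]; first by rewrite mulr_ge0.
  have v0 := C0plus_ge0 v z; have w0 := C0plus_ge0 w z.
  rewrite C0E ger0_norm ?addr_ge0// /w pospartE !C0E.
  have dz := C0_norm_ub d z; have vz := C0_norm_ub v z.
  have := ler_wpM2l N0 (le_trans (ler_norm _) dz).
  have := le_trans (ler_norm _) vz; rewrite -[C0_norm v]/(`|v%:C|) -Nd.
  by rewrite -[C0_norm d]/(`|d|); case: (leP _ 0); lra.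
have le2 : `|(N + 1) *: d| <= `|u%:C + w%:C|.
  apply: C0_le_norm => z; rewrite !C0E.
  have u0 := C0plus_ge0 u z; have w0 := C0plus_ge0 w z.
  have dz : 0 <= d z := C0plus_ge0 (pospart _) z.
  rewrite !ger0_norm ?addr_ge0 ?mulr_ge0// ?addr_ge0//.
  have : N * d z - v z <= w z.
    by rewrite /w pospartE !C0E le_max lexx.
  (* Where [d z = 0] the bound is trivial; elsewhere [w z >= N * d z - v z] gives
     [u z + w z >= (N + 1) * d z]. *)
  have : d z = 0 \/ d z = u z - v z.
    by rewrite /d pospartE !C0E; case: leP => _; [left|right].
  by case=> ->; lra.
(* The chain reads [(N + 1) * |d| <= N * |d|], impossible for [|d| > 0]. *)
have := le_trans le2 (le_trans (uv w) le1).
rewrite normrZ ger0_norm ?addr_ge0// mulrDl mul1r; lra.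
Qed.

(* The order interval between min (u, v) and max (u, v), described by the order
   alone. *)
Definition order_hull u v : set (C0plus L R) := [set t |
  (forall w, le_cone w u -> le_cone w v -> le_cone w t) /\
  (forall w, le_cone u w -> le_cone v w -> le_cone t w)].

Definition midpoint u v : C0plus L R := pospart (2^-1 *: (u%:C + v%:C)).

(** Reflection about the midpoint of [u] and [v]. The positive part keeps the value in the cone and
    changes nothing on [order_hull u v] ([flipE]). *)
Definition flip u v t : C0plus L R := pospart (u%:C + v%:C - t%:C).

Lemma midpointE u v x : midpoint u v x = 2^-1 * (u x + v x).
Proof.
rewrite pospart_id// => z; rewrite !C0E mulr_ge0 ?invr_ge0 ?addr_ge0//; exact: C0plus_ge0.
Qed.

(** Since [u] and [v] are nonnegative, [u + v] is an upper bound of both within the cone. *)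
Lemma order_hull_le u v t x : order_hull u v t -> t x <= u x + v x.
Proof.
move=> [_ /(_ (pospart (u%:C + v%:C)))].
have uv0 z : 0 <= (u%:C + v%:C) z by rewrite C0E addr_ge0//; exact: C0plus_ge0.
move=> H; have := H _ _ x; rewrite pospart_id//; apply=> z.
  by rewrite pospart_id// C0E lerDl; exact: C0plus_ge0.
by rewrite pospart_id// C0E lerDr; exact: C0plus_ge0.
Qed.

Lemma flipE u v t x : order_hull u v t -> flip u v t x = u x + v x - t x.
Proof.
by move=> At; rewrite pospart_id// => z; rewrite !C0E subr_ge0; exact: order_hull_le.
Qed.

Lemma order_hull_midpoint u v : order_hull u v (midpoint u v).
Proof.
split=> w wu wv x; rewrite midpointE; have := wu x; have := wv x; lra.
Qed.

(** The map [w |-> u + v - w] exchanges lower and upper bounds of [u] and [v], so each half of the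
    hull condition on [t] yields the other half for the reflected point. *)
Lemma order_hull_flip u v t : order_hull u v t -> order_hull u v (flip u v t).
Proof.
move=> At; have [tl tr] := At; split=> w wu wv x; rewrite flipE//.
  have tw : le_cone t (pospart (u%:C + v%:C - w%:C)).
    by apply: tr => z; rewrite pospartE !C0E le_max; have := wu z; have := wv z;
      move=> ? ?; apply/orP; left; lra.
  have := tw x; rewrite pospart_id => [|z]; rewrite !C0E; first by lra.
  by have := wu z; have := wv z; have := C0plus_ge0 u z; lra.
(* An upper bound [w] may exceed [u + v]; truncating at 0 still leaves a lower bound, as [u] and [v]
   are nonnegative. *)
have : le_cone (pospart (u%:C + v%:C - w%:C)) t.
  apply: tl => z; rewrite pospartE !C0E ge_max C0plus_ge0 andbT.
  - by have := wv z; lra.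
  - by have := wu z; lra.
by move=> /(_ x); rewrite pospartE !C0E ge_max => /andP[]; lra.
Qed.

Lemma flip_midpoint u v : flip u v (midpoint u v) = midpoint u v.
Proof.
apply: C0plusP => x; rewrite flipE; last exact: order_hull_midpoint.
by rewrite midpointE; lra.
Qed.

Lemma flipK u v t : order_hull u v t -> flip u v (flip u v t) = t.
Proof.
move=> At; apply: C0plusP => x; rewrite !flipE//; last exact: order_hull_flip.
lra.
Qed.

Lemma flip_val u v t :
  order_hull u v t -> (flip u v t)%:C = u%:C + v%:C - t%:C.
Proof. by move=> At; apply: C0P => x; rewrite flipE. Qed.

Lemma dist_flip u v s t : order_hull u v s -> order_hull u v t ->
  `|(flip u v s)%:C - (flip u v t)%:C| = `|s%:C - t%:C|.
Proof.
move=> As At; rewrite !flip_val// [in RHS]distrC.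
by congr (`| _ |); apply: C0P => x; rewrite !C0E; lra.
Qed.

Lemma dist_flip_id u v t : order_hull u v t ->
  `|(flip u v t)%:C - t%:C| = `|t%:C - (midpoint u v)%:C| *+ 2.
Proof.
move=> At; rewrite flip_val// -normrMn distrC.
by congr (`| _ |); apply: C0P => x; rewrite mulr2n !C0E midpointE; lra.
Qed.

Lemma order_hull_bounded u v s t : order_hull u v s -> order_hull u v t ->
  `|s%:C - t%:C| <= `|u%:C + v%:C|.
Proof.
move=> As At; apply: C0_le_norm => x; rewrite !C0E.
have := order_hull_le _ _ _ x As; have := order_hull_le _ _ _ x At.
have := C0plus_ge0 s x; have := C0plus_ge0 t x => ? ? ? ?.
by rewrite [leRHS]ger0_norm ?ler_norml; lra.
Qed.

End cone.

(** * Surjective phase-isometries preserve order, midpoints and sums *)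

Section phase_isometry.
Context {R : realType} {X Y : topologicalType} {T : C0plus X R -> C0plus Y R}.
Hypothesis surjT : set_surj [set: C0plus X R] [set: C0plus Y R] T.
Hypothesis phaseT : phase_isometry T.
Implicit Types u v w : C0plus X R.

Lemma set2_le_inj (a b c d : R) :
  b <= a -> d <= c -> [set a; b] = [set c; d] -> a = c /\ b = d.
Proof.
move=> ba dc e.
have : [set c; d] a by rewrite -e; left.
have : [set c; d] b by rewrite -e; right.
have : [set a; b] c by rewrite e; left.
have : [set a; b] d by rewrite e; right.
by move=> []/= ? []/= ? []/= ? []/= ?; split; lra.
Qed.

Lemma phase_isometryE u v :
  `|(T u)%:C + (T v)%:C| = `|u%:C + v%:C| /\
  `|(T u)%:C - (T v)%:C| = `|u%:C - v%:C|.
Proof. by apply: set2_le_inj (phaseT u v); exact: C0plus_normB_le_normD. Qed.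

Lemma phase_isometry_bij : exists T' : C0plus Y R -> C0plus X R,
  cancel T' T /\ cancel T T'.
Proof.
have /choice[T' T'K] : forall v : C0plus Y R, exists u, T u = v.
  by move=> v; have [u _ uv] := surjT v I; exists u.
exists T'; split=> // u; apply: C0plusP => x.
have := (phase_isometryE (T' (T u)) u).2.
by rewrite T'K subrr normr0 => /esym/normr0_eq0/subr0_eq ->.
Qed.

(** The order is read off norms of sums, which [T] preserves; surjectivity lets every test element
    of the target be written as an image. *)
Lemma phase_isometry_le u v : le_cone (T u) (T v) <-> le_cone u v.
Proof.
rewrite !le_cone_normP; split=> uv w.
  by rewrite -!(phase_isometryE _ w).1.
have [w' _ <-] := surjT w I.
by rewrite !(phase_isometryE _ w').1.
Qed.

Lemma phase_isometry_order_hull u v t :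
  order_hull (T u) (T v) (T t) <-> order_hull u v t.
Proof.
split=> -[tl tr]; split=> w.
- by move=> /phase_isometry_le wu /phase_isometry_le wv; apply/phase_isometry_le/tl.
- by move=> /phase_isometry_le wu /phase_isometry_le wv; apply/phase_isometry_le/tr.
- have [w' _ <-] := surjT w I.
  by rewrite !phase_isometry_le; exact: tl.
- have [w' _ <-] := surjT w I.
  by rewrite !phase_isometry_le; exact: tr.
Qed.

(** With [rho] and [rho'] the reflections of the two hulls and [T'] the inverse of [T], the isometry
    [rho \o T' \o rho' \o T] of the hull of [u] and [v] must fix its centre. This forces [rho'] to
    fix [T (midpoint u v)], and the only fixed point of [rho'] in its hull is the midpoint. *)
Lemma phase_isometry_midpoint u v : T (midpoint u v) = midpoint (T u) (T v).
Proof.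
have [T' [T'K TK]] := phase_isometry_bij.
have TA t : order_hull u v t -> order_hull (T u) (T v) (T t).
  by move/phase_isometry_order_hull.
have T'A t : order_hull (T u) (T v) t -> order_hull u v (T' t).
  by move=> ?; apply/phase_isometry_order_hull; rewrite T'K.
have Td s t := (phase_isometryE s t).2.
have T'd (s t : C0plus Y R) : `|(T' s)%:C - (T' t)%:C| = `|s%:C - t%:C|.
  by rewrite -Td !T'K.
have Am := order_hull_midpoint u v.
pose rho := flip u v; pose rho' := flip (T u) (T v).
have AF t : order_hull u v t -> order_hull u v (rho t) by exact: order_hull_flip.
have BF t : order_hull (T u) (T v) t -> order_hull (T u) (T v) (rho' t).
  exact: order_hull_flip.
have FK t : order_hull u v t -> rho (rho t) = t by exact: flipK.
have F'K t : order_hull (T u) (T v) t -> rho' (rho' t) = t by exact: flipK.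
have : `|(rho (T' (rho' (T (midpoint u v)))))%:C - (midpoint u v)%:C| <= 0.
  apply: (@isometry_fixes_center _ _ (fun s t : C0plus X R => `|s%:C - t%:C|)
    (order_hull u v) rho (midpoint u v) `|u%:C + v%:C|
    (rho \o T' \o rho' \o T) (T' \o rho' \o T \o rho)) => //=.
  - exact: dist_flip.
  - exact: dist_flip_id.
  - exact: flip_midpoint.
  - exact: order_hull_bounded.
  - by move=> t At; apply/AF/T'A/BF/TA.
  - by move=> t At; apply/T'A/BF/TA/AF.
  - move=> t At; rewrite T'K F'K; last exact/TA/AF.
    by rewrite TK FK.
  - move=> t At; rewrite FK; last exact/T'A/BF/TA.
    by rewrite T'K F'K ?TK//; exact: TA.
  - move=> s t As At; rewrite dist_flip; [|exact/T'A/BF/TA|exact/T'A/BF/TA].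
    by rewrite T'd dist_flip ?Td//; exact: TA.
(* Writing the centre as its own reflection, [rho] cancels from the distance; applying [T] then
   leaves the distance from [rho' (T (midpoint u v))] to [T (midpoint u v)], twice the distance to
   the midpoint of the images. *)
rewrite -[X in _%:C - X%:C](flip_midpoint u v) dist_flip//; last first.
  exact/T'A/BF/TA.
rewrite -Td T'K dist_flip_id; last exact: TA.
rewrite pmulrn_lle0// normr_le0 subr_eq0 => /eqP e.
by apply: C0plusP => x; rewrite e.
Qed.

Lemma phase_isometry0 u : (forall x, u x = 0) -> forall y, T u y = 0.
Proof.
move=> u0 y; have := (phase_isometryE u u).1.
have -> : u%:C = 0 by apply: C0P.
rewrite addr0 normr0 -mulr2n => /normr0_eq0 /(congr1 (fun h : C0 Y R => h y)).
by rewrite mulr2n C0E => /= h; have : T u y + T u y = 0 := h; lra.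
Qed.

(** The midpoint of [u + v] and 0 is that of [u] and [v], and [T] sends 0 to 0. The sum enters
    through an equation in [C0] because [C0plus] carries no addition. *)
Lemma phase_isometryD u v w :
  w%:C = u%:C + v%:C -> (T w)%:C = (T u)%:C + (T v)%:C.
Proof.
move=> wuv; pose z : C0plus X R := pospart 0.
have z0 x : z x = 0 by rewrite pospart_id.
have e : midpoint w z = midpoint u v.
  by apply: C0plusP => x; rewrite !midpointE wuv C0E z0 addr0.
apply: C0P => y; have : T (midpoint w z) y = T (midpoint u v) y by rewrite e.
rewrite !phase_isometry_midpoint !midpointE !C0E (phase_isometry0 _ z0); lra.
Qed.

(** * Extension from the cone to the whole space *)

Definition cone_extension (f : C0 X R) : C0 Y R :=
  (T (pospart f))%:C - (T (pospart (- f)))%:C.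

(** The extension may be computed from any decomposition into a difference of cone elements: the
    identity [f^+ + v = u + f^-] holds inside the cone, where [T] is additive. *)
Lemma cone_extensionB u v :
  cone_extension (u%:C - v%:C) = (T u)%:C - (T v)%:C.
Proof.
rewrite /cone_extension; set f := u%:C - v%:C.
have e : (pospart f)%:C + v%:C = u%:C + (pospart (- f))%:C.
  apply: C0P => x; rewrite !C0E.
  have : pospart f x - pospart (- f) x = f x.
    by rewrite -[in RHS](pospartB f) !C0E.
  by rewrite /f !C0E; lra.
have p0 x : 0 <= ((pospart f)%:C + v%:C) x.
  by rewrite C0E addr_ge0//; exact: C0plus_ge0.
have h1 := phase_isometryD (pospart f) v _ (pospart_id _ p0).
have := phase_isometryD u (pospart (- f)) _ (etrans (pospart_id _ p0) e).
by rewrite h1 => h; apply/eqP; rewrite subr_eq addrAC -h addrK.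
Qed.

End phase_isometry.

Theorem corollary1p2 (R : realType) (X Y : topologicalType)
    (hX : hausdorff_space X) (lX : locally_compact [set: X])
    (hY : hausdorff_space Y) (lY : locally_compact [set: Y])
    (T : C0plus X R -> C0plus Y R)
    (surjT : set_surj [set: C0plus X R] [set: C0plus Y R] T)
    (phaseT : phase_isometry T) :
  exists! S : C0 X R -> C0 Y R,
    [/\ linear S,
        set_surj [set: C0 X R] [set: C0 Y R] S,
        isometric_map S
      & forall f : C0plus X R, S f = T f].
Proof.
pose S := cone_extension (T := T).
have SB := cone_extensionB surjT phaseT.
have TD := phase_isometryD surjT phaseT.
have addE (u v : C0plus X R) : (pospart (u%:C + v%:C))%:C = u%:C + v%:C.
  by apply: pospart_id => x; rewrite C0E addr_ge0//; exact: C0plus_ge0.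
have SD : {morph S : f g / f + g}.
  (* The sum [f + g] is decomposed as [(f^+ + g^+) - (f^- + g^-)], in general not its decomposition
     into positive and negative parts. *)
  move=> f g; pose u := pospart ((pospart f)%:C + (pospart g)%:C).
  pose v := pospart ((pospart (- f))%:C + (pospart (- g))%:C).
  have -> : f + g = u%:C - v%:C.
    by rewrite !addE opprD addrACA !pospartB.
  by rewrite [LHS]SB (TD _ _ u (addE _ _)) (TD _ _ v (addE _ _)) opprD addrACA.
have SN f : S (- f) = - S f by rewrite /S /cone_extension opprK opprB.
have Si : isometric_map S.
  (* Additivity reduces the claim to the norm of [S h] for [h = f - g], and [S h] is by definition a
     difference of [T]-images of [h^+] and [h^-], whose distance [T] preserves. *)
  move=> f g; rewrite -SN -SD -[in RHS](pospartB (f - g)).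
  by rewrite /S /cone_extension (phase_isometryE phaseT _ _).2.
have ST (u : C0plus X R) : S u%:C = (T u)%:C.
  pose z : C0plus X R := pospart 0.
  have zE : z%:C = 0 by apply: pospart_id => x.
  have := SB u z; rewrite zE subr0 /S => ->; apply: C0P => y.
  by rewrite !C0E (phase_isometry0 phaseT z) ?subr0// => x; rewrite zE.
exists S; split=> [|S' [S'l _ _ S'T]].
  split=> //; first exact: additive_isometry_linear.
  move=> g _; have [u _ ug] := surjT (pospart g) I.
  have [v _ vg] := surjT (pospart (- g)) I.
  by exists (u%:C - v%:C) => //; rewrite /S SB ug vg pospartB.
(* Uniqueness: a linear map is determined by its values on the cone, since [f = f^+ - f^-]. *)
apply/funext => f; rewrite -{2}(pospartB f) addrC -scaleN1r S'l !S'T scaleN1r.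
by rewrite addrC.
Qed.
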